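(* Let $n\ge2$, and let $g$ be a positive $C^2$ probability density on $\mathbb{R}^n$. Then the following are equivalent. (i) For every compactly supported probability measure $\mu$ on $\mathbb{R}^n$ and every smooth continuous contraction $\{T_t\}_{t\in[0,1]}$, the canonical velocity field $$\widetilde v_t=\frac{(v_t\mu_t)*g}{\mu_t*g},\qquad \mu_t=(T_t)_\#\mu,$$ where $v_t$ is the velocity field of $\mu_t$, satisfies $\operatorname{div}\widetilde v_t\le0$ (everywhere on $\mathbb{R}^n$, for every $t$). (ii) Up to translation, $g$ is an isotropic Gaussian density; that is, there are $a\in\mathbb{R}^n$ and $s>0$ with $g(x)=(2\pi s)^{-n/2}e^{-\|x-a\|_2^2/(2s)}$ for all $x$.
   Context: A continuous contraction (on a set $K\subseteq\mathbb{R}^n$) is a homotopy $\{T_t\}_{t\in[0,1]}$ of maps $K\to\mathbb{R}^n$ with $T_0$ the identity such that $\|T_t(x)-T_t(y)\|_2$ is nonincreasing in $t$ for every $x,y\in K$. Here $K$ is compact and contains the support of $\mu$, and the contraction is smooth in the sense that the trajectories $t\mapsto T_t(x)$ are $C^1$ on $[0,1]$ with $(t,x)\mapsto\frac{d}{dt}T_t(x)$ continuous on $[0,1]\times K$. The velocity field $v_t$ of $\mu_t=(T_t)_\#\mu$ is given by $v_t(T_t(x))=\frac{d}{dt}T_t(x)$; thus the vector measure $v_t\mu_t$ is $(T_t)_\#\big(\frac{d}{dt}T_t\,\mu\big)$, and $$\widetilde v_t(z)=\frac{\int_K g(z-T_t(x))\,\frac{d}{dt}T_t(x)\,d\mu(x)}{\int_K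 g(z-T_t(x))\,d\mu(x)},\qquad z\in\mathbb{R}^n.$$ *)

(* Defs.v *)
From HB Require Import structures.
From mathcomp Require Import all_boot all_order all_algebra.
From mathcomp Require Import all_classical all_reals all_analysis measurable_realfun.

Set Implicit Arguments.
Unset Strict Implicit.
Unset Printing Implicit Defensive.

Import Order.TTheory GRing.Theory Num.Theory.
Import numFieldNormedType.Exports.

Local Open Scope classical_set_scope.
Local Open Scope ring_scope.

Notation borel_rV R n := (g_sigma_algebraType (@open 'rV[R]_n)).

Section borel_rV.
Context {R : realType}.

Lemma open_rat_box n (U : set 'rV[R]_n) (v : 'rV[R]_n) : open U -> U v ->
  exists q : 'rV[rat]_n * nat,
    (forall i, `|v ord0 i - ratr (q.1 ord0 i)| < q.2.+1%:R^-1) /\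
    [set w : 'rV[R]_n |
      forall i, `|w ord0 i - ratr (q.1 ord0 i)| < q.2.+1%:R^-1] `<=` U.
Proof.
move=> oU Uv.
have /nbhs_ballP[e /= e0 veU] : nbhs v U by exact: open_nbhs_nbhs.
have [N Ne] : exists N : nat, N.+1%:R^-1 < e / 2.
  have [N] := ltr_add_invr (y := 0) (x := e / 2) (divr_gt0 e0 (ltr0Sn _ _)).
  by rewrite add0r => ?; exists N.
have q_ i : {r : rat | `|v ord0 i - ratr r| < N.+1%:R^-1}.
  apply: cid; have N0 : 0 < N.+1%:R^-1 :> R by rewrite invr_gt0.
  have [] := @dense_rat R (ball (v ord0 i) N.+1%:R^-1).
  - by exists (v ord0 i); exact: ballxx.
  - exact: ball_open.
  - by move=> _ [] /[swap] [[r _ <-]] vr; exists r.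
exists (\row_i sval (q_ i), N) => /=; split.
  by move=> i; rewrite mxE; case: (q_ i).
move=> w wq; apply: veU; split => // i j.
rewrite [i]ord1; have := wq j; rewrite mxE.
case: (q_ j) => r /= vr wr.
rewrite /ball /= (@le_lt_trans _ _ (`|v ord0 j - ratr r| + `|w ord0 j - ratr r|))//.
  by rewrite [X in _ <= _ + X]distrC; exact: ler_distD.
by rewrite (splitr e) ltrD// (lt_trans _ Ne).
Qed.

Lemma measurable_fun_rV d (X : measurableType d) n (f : X -> borel_rV R n) :
  (forall i, measurable_fun [set: X] (fun x => (f x : 'rV[R]_n) ord0 i)) ->
  measurable_fun [set: X] f.
Proof.
move=> mf; apply: (@measurability _ _ X (borel_rV R n) setT f (@open 'rV[R]_n) erefl).
move=> _ [U oU <-].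
pose B (q : 'rV[rat]_n * nat) : set 'rV[R]_n :=
  [set w | forall i, `|w ord0 i - ratr (q.1 ord0 i)| < q.2.+1%:R^-1].
have -> : [set: X] `&` f @^-1` U =
    \bigcup_(q in [set q | B q `<=` U]) (f @^-1` B q).
  apply/seteqP; split=> [x [_ Ux]|x [q /= BU Bx]]; last by split => //; exact: BU.
  by have [q [? ?]] := open_rat_box oU Ux; exists q.
rewrite bigcup_mkcond; apply: countable_bigcupT_measurable; first exact: countableP.
move=> q; case: ifPn => // _.
have -> : f @^-1` B q = \bigcap_(i in [set: 'I_n])
    ([set: X] `&` (fun x => `|(f x : 'rV[R]_n) ord0 i - ratr (q.1 ord0 i)|) @^-1`
       `]-oo, q.2.+1%:R^-1[).
  apply/seteqP; split=> [x Bx i _|x Bx i] /=.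
    by split => //; rewrite in_itv/=; exact: Bx.
  by have /= := Bx i I; rewrite in_itv/= => -[].
apply: fin_bigcap_measurable => // i _.
have : measurable_fun [set: X]
    (fun x => `|(f x : 'rV[R]_n) ord0 i - ratr (q.1 ord0 i)|).
  by apply: measurableT_comp => //; apply: measurable_funB.
by apply.
Qed.

Lemma measurable_coord_rV n (i : 'I_n) :
  measurable_fun [set: borel_rV R n] (fun x => (x : 'rV[R]_n) ord0 i).
Proof.
apply: (measurability _ (RGenOpens.measurableE R)) => _ [_ [a [b ->]] <-].
rewrite setTI; apply: sub_sigma_algebra.
apply: open_comp; last exact: interval_open.
by move=> x _; exact: coord_continuous.
Qed.

End borel_rV.

Section lebesgue_rV.
Context {R : realType}.

Definition cons_coord n (p : measurableTypeR R * borel_rV R n) : borel_rV R n.+1 :=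
  @row_mx R 1 1 n (p.1 : R)%:M (p.2 : 'rV[R]_n).

Lemma measurable_cons_coord n : measurable_fun setT (@cons_coord n).
Proof.
apply: measurable_fun_rV => i.
rewrite /cons_coord; rewrite -[i](@splitK 1 n).
case: (@fintype.split 1 n i) => j /=.
- rewrite [X in measurable_fun _ X](_ : _ = fst) //.
  by apply/funext => -[x y] /=; rewrite (@row_mxEl R 1 1 n) [j]ord1 mxE eqxx.
- rewrite [X in measurable_fun _ X](_ : _ =
    (fun y : borel_rV R n => (y : 'rV[R]_n) ord0 j) \o snd).
    by apply: measurableT_comp => //; exact: measurable_coord_rV.
  by apply/funext => -[x y] /=; rewrite (@row_mxEr R 1 1 n).
Qed.

(* the n-fold product of the Lebesgue measure of R, carried over to 'rV[R]_n *)
Fixpoint lebesgue_rV (n : nat) : set (borel_rV R n) -> \bar R :=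
  match n with
  | 0 => @dirac _ (borel_rV R 0) (0 : 'rV_0) R
  | n'.+1 => pushforward (lebesgue_measure \x @lebesgue_rV n')%E (@cons_coord n')
  end.

Let cube n (k : nat) : set (borel_rV R n) :=
  [set v | forall i, `|(v : 'rV[R]_n) ord0 i| <= k%:R].

Let measurable_cube n k : measurable (@cube n k).
Proof.
have -> : @cube n k = \bigcap_(i in [set: 'I_n])
    ([set: borel_rV R n] `&` (fun x => (x : 'rV[R]_n) ord0 i) @^-1`
       `[(- k%:R), k%:R]).
  apply/seteqP; split=> [x Bx i _|x Bx i] /=.
    by split => //; rewrite in_itv/= -ler_norml; exact: Bx.
  by have /= := Bx i I; rewrite in_itv/= -ler_norml => -[].
apply: fin_bigcap_measurable => // i _.
by apply: measurable_coord_rV.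
Qed.

Let cube_sigma_finite n (mu : {measure set (borel_rV R n) -> \bar R}) :
  (forall k, mu (@cube n k) < +oo)%E -> sigma_finite setT mu.
Proof.
move=> fin; exists (@cube n) => //.
apply/seteqP; split => // v _ /=.
exists (Num.truncn (mx_norm (v : 'rV[R]_n))).+1 => // i.
apply: le_trans (ltW (truncnS_gt _)).
rewrite [leRHS]mx_normrE; apply/bigmax_geP; right => /=.
by exists (ord0, i).
Qed.

Let lebesgue_rV_spec n :
  {mu : {sigma_finite_measure set (borel_rV R n) -> \bar R} |
    @lebesgue_rV n = mu & forall k, (mu (@cube n k) < +oo)%E}.
Proof.
elim: n => [|n [mu muE muc]].
  exists (@dirac _ (borel_rV R 0) (0 : 'rV_0) R) => // k.
  by rewrite /= diracE ltry.
have mr := @measurable_cons_coord n.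
pose nu : {measure set (borel_rV R n.+1) -> \bar R} :=
  measure_function_pushforward__canonical__measure_function_Measure
    [the {measure set _ -> \bar R} of (lebesgue_measure \x mu)%E] mr.
have nuc k : (nu (@cube n.+1 k) < +oo)%E.
  rewrite /nu /= /pushforward.
  have -> : @cons_coord n @^-1` @cube n.+1 k = `[- k%:R, k%:R]%classic `*` @cube n k.
    apply/seteqP; split => -[x y].
      move=> h; split => [|j] /=.
        have := h (@lshift 1 n ord0).
        by rewrite /cons_coord (@row_mxEl R 1 1 n) mxE eqxx ler_norml in_itv.
      by have := h (@rshift 1 n j); rewrite /cons_coord (@row_mxEr R 1 1 n).
    move=> [/= xk yk] i; rewrite -[i](@splitK 1 n).
    case: (@fintype.split 1 n i) => j /=.
      rewrite /cons_coord (@row_mxEl R 1 1 n) [j]ord1 mxE eqxx ler_norml.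
      by move: xk; rewrite in_itv.
    by rewrite /cons_coord (@row_mxEr R 1 1 n); exact: yk.
  rewrite product_measure1E//; last exact: measurable_cube.
  apply: lte_mul_pinfty; [exact: measure_ge0| |exact: muc].
  suff: lebesgue_measure (`[- k%:R, k%:R]%classic : set R) \is a fin_num by [].
  rewrite lebesgue_measure_itv /=.
  by case: ifP => // _; rewrite -EFinD.
have sfnu := cube_sigma_finite nuc.
pose sf := Measure_isSigmaFinite.Build _ _ _ nu sfnu.
pose nu' : {sigma_finite_measure set (borel_rV R n.+1) -> \bar R} :=
  HB.pack (nu : set _ -> \bar R) (Measure.class nu) sf.
by exists nu'; [rewrite /= muE | exact: nuc].
Qed.

Let lebesgue_rV0 n : @lebesgue_rV n set0 = 0%E.
Proof. by have [mu -> _] := lebesgue_rV_spec n; exact: measure0. Qed.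

Let lebesgue_rV_ge0 n A : (0 <= @lebesgue_rV n A)%E.
Proof. by have [mu -> _] := lebesgue_rV_spec n; exact: measure_ge0. Qed.

Let lebesgue_rV_semi_sigma_additive n : semi_sigma_additive (@lebesgue_rV n).
Proof.
by have [mu -> _] := lebesgue_rV_spec n; exact: measure_semi_sigma_additive.
Qed.

HB.instance Definition _ n := isMeasure.Build _ _ _ (@lebesgue_rV n)
  (@lebesgue_rV0 n) (@lebesgue_rV_ge0 n) (@lebesgue_rV_semi_sigma_additive n).

Let lebesgue_rV_sigma_finite n : sigma_finite setT (@lebesgue_rV n).
Proof. by have [mu -> _] := lebesgue_rV_spec n; exact: sigma_finiteT. Qed.

HB.instance Definition _ n := Measure_isSigmaFinite.Build _ _ _ (@lebesgue_rV n)
  (@lebesgue_rV_sigma_finite n).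

End lebesgue_rV.

Arguments lebesgue_rV : clear implicits.

Section contraction.
Context {R : realType} {n : nat}.
Local Notation V := 'rV[R]_n.

(* the norm of 'rV[R]_n in the library is the sup norm *)
Definition enorm (x : V) : R := Num.sqrt (\sum_(i < n) x ord0 i ^+ 2).

Definition partial (i : 'I_n) (f : V -> R) (x : V) : R :=
  'D_(delta_mx ord0 i) f x.

Definition is_C1 (f : V -> R) : Prop :=
  continuous f /\
  forall i : 'I_n, (forall x : V, derivable f x (delta_mx ord0 i)) /\
                   continuous (partial i f).

Definition is_C2 (f : V -> R) : Prop :=
  is_C1 f /\ forall i : 'I_n, is_C1 (partial i f).

Definition divergence (F : V -> V) (x : V) : R :=
  \sum_(i < n) partial i (fun y => F y ord0 i) x.

Definition msupport (mu : set (borel_rV R n) -> \bar R) : set V :=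
  [set x | forall U : set V, open U -> U x -> (0 < mu U)%E].

(* A homotopy of maps K -> 'rV[R]_n is a total function T : R -> V -> V of which
   only the restriction to [0, 1] x K matters. *)
Definition trajectory_quotient (T : R -> V -> V) (t : R) (x : V) : R -> V :=
  fun s => (s - t)^-1 *: (T s x - T t x).

(* d/dt (T_t x) along [0, 1]: two-sided inside, one-sided at 0 and 1 *)
Definition velocity (T : R -> V -> V) (t : R) (x : V) : V :=
  lim (trajectory_quotient T t x @ within `[0, 1] t^').

Record continuous_contraction (K : set V) (T : R -> V -> V) : Prop := {
  contraction_homotopy :
    {within `[0, 1] `*` K, continuous (fun p : R * V => T p.1 p.2)} ;
  contraction_id : forall x, K x -> T 0 x = x ;
  contraction_nonincreasing : forall x y, K x -> K y ->
    forall s t, 0 <= s -> s <= t -> t <= 1 ->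
      enorm (T t x - T t y) <= enorm (T s x - T s y) }.

Record smooth_contraction (K : set V) (T : R -> V -> V) : Prop := {
  smooth_contraction_contraction : continuous_contraction K T ;
  smooth_contraction_derivable : forall x, K x -> forall t, 0 <= t <= 1 ->
    cvg (trajectory_quotient T t x @ within `[0, 1] t^') ;
  smooth_contraction_velocity :
    {within `[0, 1] `*` K, continuous (fun p : R * V => velocity T p.1 p.2)} }.

Section canonical_velocity.
Variables (g : V -> R) (mu : probability (borel_rV R n) R) (K : set V).
Variables (T : R -> V -> V) (t : R).

(* mu_t * g, where mu_t is the image of mu by T_t *)
Definition smoothed_density (z : V) : R :=
  \int[mu]_(x in K) g (z - T t x).

(* (v_t mu_t) * g, where v_t mu_t is the image by T_t of the vector measure
   (d/dt T_t) mu; this makes sense even when T_t is not injective *)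
Definition smoothed_momentum (z : V) : V :=
  \row_(i < n) \int[mu]_(x in K) (g (z - T t x) * velocity T t x ord0 i).

Definition canonical_velocity (z : V) : V :=
  (smoothed_density z)^-1 *: smoothed_momentum z.

End canonical_velocity.

Definition is_isotropic_gaussian (g : V -> R) : Prop :=
  exists (a : V) (s : R), 0 < s /\
    forall x, g x = (2 * pi * s) `^ (- (n%:R / 2)) *
                    expR (- (enorm (x - a) ^+ 2 / (2 * s))).

End contraction.

(* Main.v *)
(* Writing [v] for [d/dt T_t] and [f = grad log g], the quotient rule expresses
   the divergence of the canonical velocity field at [z] as a positive multiple of
     \int\int g(z - T_t x) g(z - T_t x')
       <f(z - T_t x) - f(z - T_t x'), v x - v x'> dmu(x) dmu(x').
   For a Gaussian the gradient difference is a positive multiple of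
   [T_t x - T_t x'], and [<T_t x - T_t x', v x - v x'> <= 0] because it is half the
   derivative of the nonincreasing function [|T_t x - T_t x'|^2].
   Conversely, two-point measures, with one point moved along any [w] such that
   [<p - q, w> < 0] while the other one is fixed, show that [f u - f u'] is always
   a nonpositive multiple of [u - u'].  In dimension at least 2 this forces
   [f u = c - l u] with a constant [l >= 0]; integrating along coordinate lines, [g]
   is the exponential of a quadratic polynomial, and [\int g = 1] excludes [l = 0]
   and determines the constant. *)
Require Import Defs.
From HB Require Import structures.
From mathcomp Require Import all_boot all_order all_algebra.
From mathcomp Require Import all_classical all_reals all_analysis measurable_realfun.
From mathcomp Require Import ring lra.

Set Implicit Arguments.
Unset Strict Implicit.
Unset Printing Implicit Defensive.

Import Order.TTheory GRing.Theory Num.Theory.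
Import numFieldNormedType.Exports.

Local Open Scope classical_set_scope.
Local Open Scope ring_scope.

(** * Integrals over compact sets of row vectors *)

Section borel_rV_continuity.
Context {R : realType} {n : nat}.
Local Notation V := 'rV[R]_n.

Lemma open_measurable_rV (U : set V) : open U -> measurable (U : set (borel_rV R n)).
Proof. by move=> oU; exact: sub_sigma_algebra. Qed.

Lemma closed_measurable_rV (U : set V) :
  closed U -> measurable (U : set (borel_rV R n)).
Proof.
move=> cU; rewrite -(setCK U); apply: measurableC.
by apply: open_measurable_rV; exact: closed_openC.
Qed.

Lemma compact_measurable_rV (K : set V) :
  compact K -> measurable (K : set (borel_rV R n)).
Proof.
move=> cK; apply: closed_measurable_rV; apply: compact_closed cK.
exact: (@norm_hausdorff R V).
Qed.

Lemma within_continuous_measurable_rV (K : set V) (f : V -> R) : compact K ->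
  {within K, continuous f} -> measurable_fun (K : set (borel_rV R n)) f.
Proof.
move=> cK /continuousP cf.
apply: (measurability _ (RGenOpens.measurableE R)) => _ [_ [a [b ->] <-]].
have /open_subspaceP[W oW] : open (f @^-1` `]a, b[%classic : set (subspace K)).
  by apply: cf; exact: interval_open.
rewrite setIC [in RHS]setIC => <-; apply: measurableI.
  exact: compact_measurable_rV.
exact: open_measurable_rV.
Qed.

Lemma continuous_compact_integrable_rV
    (mu : {finite_measure set (borel_rV R n) -> \bar R}) (K : set V) (f : V -> R) :
  compact K -> {within K, continuous f} -> mu.-integrable K (EFin \o f).
Proof.
move=> cK cf; apply: measurable_bounded_integrable.
- exact: compact_measurable_rV.
- by rewrite ltey_eq fin_num_measure//; exact: compact_measurable_rV.
- exact: within_continuous_measurable_rV.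
- have [M [Mr MfK]] := compact_bounded (continuous_compact cf cK).
  by exists M; split => // N MN x Kx; apply: MfK => //; exists x.
Qed.

(** The difference quotients of [f] at [z + h *: v] along [v] and of its restriction to the line at
    [h] are the same function. One-variable calculus thus applies to partial derivatives. *)
Lemma is_derive_line (f : V -> R) (z v : V) (h df : R) :
  is_derive (z + h *: v) v f df -> is_derive h 1 (fun t => f (z + t *: v)) df.
Proof.
move=> [fd <-].
have E : (fun t : R => t^-1 *: (((fun t => f (z + t *: v)) \o shift h) (t *: 1)
    - f (z + h *: v))) = (fun t => t^-1 *: ((f \o shift (z + h *: v)) (t *: v) -
    f (z + h *: v))).
  apply/funext => t; congr (_ *: (f _ - _)).
  by rewrite /= /shift /= scaler1 scalerDl addrCA.
split; last by rewrite /derive E.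
by rewrite /derivable E.
Qed.

Lemma derive_lineP (f : V -> R) (z v : V) (df : R) :
  t^-1 *: (f (z + t *: v) - f z) @[t --> 0^'] --> df -> is_derive z v f df.
Proof.
have E : (fun t : R => t^-1 *: (f (z + t *: v) - f z)) =
    (fun t => t^-1 *: ((f \o shift z) (t *: v) - f z)).
  by apply/funext => t; congr (_ *: (f _ - _)); exact: addrC.
rewrite E => fdf; split; last exact/cvg_lim.
by apply/cvg_ex; exists df.
Qed.

(** Differentiation under the integral sign along the line [z + h *: e], [|h| < 1], where a constant
    dominates the derivative. It serves the smoothed density with [c = 1] and the momentum with [c]
    a coordinate of the velocity. *)
Lemma is_derive_integral_translate
    (mu : {finite_measure set (borel_rV R n) -> \bar R}) (K : set V)
    (g : V -> R) (y : V -> V) (c : V -> R) (i : 'I_n) (z : V) :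
  is_C1 g -> compact K -> {within K, continuous y} -> {within K, continuous c} ->
  is_derive z (delta_mx ord0 i) (fun u => \int[mu]_(x in K) (g (u - y x) * c x))
    (\int[mu]_(x in K) (partial i g (z - y x) * c x)).
Proof.
move=> [cg g1] cK cy cc; have [gd cdg] := g1 i.
set e := delta_mx ord0 i.
have cont_int (h : V -> R) (u : V) : continuous h ->
    {within K, continuous (fun x => h (u - y x) * c x)}.
  move=> ch x; apply: cvgM; last exact: cc.
  have cu : {for y x, continuous (fun w : V => h (u - w))}.
    apply: (@continuous_comp _ _ _ (fun w : V => u - w) h); last exact: ch.
    apply: (@cvgB R V V (nbhs (y x)) _ (cst u) id u (y x)); last exact: cvg_id.
    exact: (@cvg_cst V u V (nbhs (y x))).
  exact: (@continuous_comp (subspace K) _ _ y (fun w => h (u - w)) x (cy x) cu).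
(* The pair [(h, y x)] ranges over the compact product of [[-1, 1]] and the image of [K] under [y],
   on which a continuous function is bounded. *)
have [M1 M1P] : exists M1 : R, forall (h : R) (x : V), `|h| <= 1 -> K x ->
    `|partial i g (z + h *: e - y x)| <= M1.
  have cS : compact (`[-1, 1] `*` (y @` K) : set (R * V)).
    by apply: compact_setX; [exact: segment_compact|exact: continuous_compact].
  have cF : continuous (fun p : R * V => partial i g (z + p.1 *: e - p.2)).
    move=> p; apply: (@continuous_comp _ _ _ (fun p : R * V => z + p.1 *: e - p.2)
      (partial i g)); last exact: cdg.
    apply: (@cvgB _ V _ _ _ (fun p : R * V => z + p.1 *: e) snd
      (z + p.1 *: e) p.2); last exact: cvg_snd.
    apply: (@cvgD _ V _ _ _ (cst z) (fun p : R * V => p.1 *: e) z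
      (p.1 *: e)); first apply: cvg_cst.
    by apply: cvgZ; [exact: cvg_fst|apply: cvg_cst].
  have [M [_ MP]] := compact_bounded (continuous_compact (continuous_subspaceT cF) cS).
  exists (M + 1) => h x h1 Kx; apply: (MP (M + 1)); first by rewrite ltrDl.
  exists (h, y x) => //; split; last by exists x.
  by rewrite /= in_itv /= -ler_norml.
have [M2 M2P] : exists M2 : R, forall x, K x -> `|c x| <= M2.
  have [M [_ MP]] := compact_bounded (continuous_compact cc cK).
  by exists (M + 1) => x Kx; apply: (MP (M + 1)); [rewrite ltrDl|exists x].
have dline (h : R) (x : V) : is_derive h 1 (fun t => g (z + t *: e - y x) * c x)
    (partial i g (z + h *: e - y x) * c x).
  have -> : (fun t => g (z + t *: e - y x) * c x) =
      c x \*: (fun t => g (z - y x + t *: e)).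
    by apply/funext => t; rewrite addrAC mulrC.
  rewrite mulrC addrAC; apply: is_deriveZ; apply: is_derive_line.
  by apply: DeriveDef.
pose f (h : R) (x : borel_rV R n) : R := g (z + h *: e - y x) * c x.
have d1E (h : R) (x : V) : partial1of2 f h x = partial i g (z + h *: e - y x) * c x.
  by rewrite partial1of2E; have [_] := dline h x.
have f_int (h : R) : `]-1, 1[%classic h -> mu.-integrable K (EFin \o f h).
  by move=> _; apply: continuous_compact_integrable_rV => //; exact: cont_int.
have f_der (h : R) (x : V) : `]-1, 1[%classic h -> K x -> derivable (f ^~ x) h 1.
  by move=> _ _; have [] := dline h x.
(* The absolute value makes the dominating constant nonnegative even when [K] is empty, where
   nothing fixes the signs of [M1] and [M2]. *)
have M_ge0 (x : borel_rV R n) : 0 <= cst `|M1 * M2| x by exact: normr_ge0.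
have M_int : mu.-integrable K (EFin \o (cst `|M1 * M2| : borel_rV R n -> R)).
  apply: continuous_compact_integrable_rV => //.
  by apply: continuous_subspaceT; exact: cst_continuous.
have f_M (h : R) (x : V) : `]-1, 1[%classic h -> K x ->
    `|partial1of2 f h x| <= cst `|M1 * M2| x.
  rewrite /= in_itv /= => /andP[/ltW h1 /ltW h2] Kx; rewrite d1E normrM.
  apply: le_trans (ler_norm _); apply: ler_pM => //; last exact: M2P.
  by apply: M1P => //; rewrite ler_norml h1.
have I0 : `]-1, 1[%classic (0 : R) by rewrite /= in_itv /= ltr01 ltrN10.
have := cvg_differentiation_under_integral (compact_measurable_rV cK) I0 f_int
  f_der M_ge0 M_int f_M.
rewrite (_ : \int[mu]_(x in K) partial1of2 f 0 x =
    \int[mu]_(x in K) (partial i g (z - y x) * c x)); last first.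
  by apply: eq_Rintegral => x _; rewrite d1E scale0r addr0.
move=> df; apply: derive_lineP; apply: cvg_trans df; apply: near_eq_cvg.
apply: nearW => t; congr (_ *: (_ - _)); apply: eq_Rintegral => x _ //.
  by rewrite /f addr0.
by rewrite /f scale0r addr0.
Qed.

End borel_rV_continuity.

(** * Integrals of products over row vectors *)

Section integral_rV.
Context {R : realType}.

Lemma cons_coord0 n (p : measurableTypeR R * borel_rV R n) :
  (cons_coord p : 'rV[R]_n.+1) ord0 ord0 = p.1.
Proof.
have -> : ord0 = @lshift 1 n ord0 by apply: val_inj.
by rewrite /cons_coord (@row_mxEl R 1 1 n) mxE eqxx.
Qed.

Lemma cons_coordS n (p : measurableTypeR R * borel_rV R n) (i : 'I_n) :
  (cons_coord p : 'rV[R]_n.+1) ord0 (lift ord0 i) = (p.2 : 'rV[R]_n) ord0 i.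
Proof.
have -> : lift ord0 i = @rshift 1 n i by apply: val_inj.
by rewrite /cons_coord (@row_mxEr R 1 1 n).
Qed.

Lemma measurable_prod_coord n (h : 'I_n -> R -> R) :
  (forall i, measurable_fun [set: R] (h i)) ->
  measurable_fun [set: borel_rV R n]
    (fun x => \prod_(i < n) h i ((x : 'rV[R]_n) ord0 i)).
Proof.
move=> mh; apply: measurable_prod => i _.
by apply: measurableT_comp => //; exact: measurable_coord_rV.
Qed.

(** Induction on the dimension: Tonelli's theorem splits off the first coordinate. The common value
    [c] may be infinite, which is what later excludes exponentials of affine functions. *)
Lemma integral_prod_coord n (h : 'I_n -> R -> R) (c : \bar R) :
  (forall i, measurable_fun [set: R] (h i)) -> (forall i x, 0 <= h i x) ->
  (forall i, \int[@lebesgue_measure R]_x (h i x)%:E = c)%E ->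
  (\int[lebesgue_rV R n]_x (\prod_(i < n) h i ((x : 'rV[R]_n) ord0 i))%:E = c ^+ n)%E.
Proof.
elim: n h => [|n IH] h mh h0 hc.
  rewrite /= integral_dirac//=.
    by rewrite diracE mem_set// mul1e big_ord0.
  by apply/measurable_EFinP; exact: measurable_prod_coord.
pose P := (@lebesgue_measure R \x lebesgue_rV R n)%E.
pose F (x : borel_rV R n.+1) := (\prod_(i < n.+1) h i ((x : 'rV[R]_n.+1) ord0 i))%:E.
have mF : measurable_fun setT F 
  by apply/measurable_EFinP; apply: measurable_prod_coord.
have F0 x : (0 <= F x)%E by rewrite lee_fin; exact: prodr_ge0.
have FE p : (F \o @cons_coord R n) p = (h ord0 p.1 *
    \prod_(i < n) h (lift ord0 i) ((p.2 : 'rV[R]_n) ord0 i))%:E.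
  rewrite /= /F big_ord_recl cons_coord0; congr (_ * _)%:E.
  by apply: eq_bigr => i _; rewrite cons_coordS.
transitivity (\int[P]_p F (cons_coord p))%E.
  apply: (ge0_integral_pushforward (@measurable_cons_coord R n) P) => // x _; exact: F0.
rewrite /P (@fubini_tonelli1 _ _ _ _ _ _ _ (F \o @cons_coord R n)); last 2 first.
  exact: (measurableT_comp mF (@measurable_cons_coord R n)).
  by move=> p; exact: F0.
rewrite /fubini_F.
have cE : c = (\int[@lebesgue_measure R]_x (h ord0 x)%:E)%E by rewrite hc.
have c0 : (0 <= c)%E by rewrite cE integral_ge0// => x _; rewrite lee_fin.
under eq_integral.
  move=> x _; under eq_integral do rewrite FE EFinM /=.
  rewrite ge0_integralZl//; last 3 first.
  - apply/measurable_EFinP.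
    exact: (measurable_prod_coord (h := fun i => h (lift ord0 i))).
  - by move=> y _; rewrite lee_fin; exact: prodr_ge0.
  - by rewrite lee_fin.
  rewrite (IH (fun i => h (lift ord0 i)))//.
  over.
rewrite ge0_integralZr//; last 3 first.
- by apply/measurable_EFinP; exact: mh.
- by move=> x _; rewrite lee_fin.
- exact: expe_ge0.
by rewrite hc expeS.
Qed.

(** The integrand is the normal density with standard deviation [Num.sqrt s] divided by its peak
    value, and that density has mass 1. *)
Lemma integral_gaussian (a s : R) : 0 < s ->
  (\int[@lebesgue_measure R]_x (expR (- ((x - a) ^+ 2 / (2 * s))))%:E =
   (Num.sqrt (2 * pi * s))%:E)%E.
Proof.
move=> s0.
have pE : normal_peak (Num.sqrt s) = (Num.sqrt (2 * pi * s))^-1.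
  by rewrite /normal_peak sqr_sqrtr ?ltW// -mulr_natl; congr (Num.sqrt _)^-1; ring.
have p0 : Num.sqrt (2 * pi * s) != 0.
  by rewrite gt_eqF// sqrtr_gt0 !mulr_gt0// pi_gt0.
rewrite -[RHS]mule1 -(integral_normal_pdf a (Num.sqrt s)).
rewrite -ge0_integralZl//; last 2 first.
- by apply/measurable_EFinP; exact: measurable_normal_pdf.
- by move=> x _; rewrite lee_fin normal_pdf_ge0.
apply: eq_integral => x _; rewrite -EFinM normal_pdfE ?gt_eqF ?sqrtr_gt0//.
rewrite pE mulVKf//.
by rewrite /normal_fun sqr_sqrtr ?ltW// mulNr mulr_natl.
Qed.

(** On a half-line chosen by the sign of [c] the exponent is nonnegative, so the integrand dominates
    the indicator of a set of infinite length. *)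
Lemma integral_expR_infty (c : R) :
  (\int[@lebesgue_measure R]_x (expR (c * x))%:E = +oo)%E.
Proof.
suff [D mD [Doo Dc]] : exists2 D : set R, measurable D &
    (@lebesgue_measure R D = +oo)%E /\ forall x, D x -> 0 <= c * x.
  apply/eqP; rewrite -leye_eq -Doo -(setIT D) -integral_indic//.
  apply: ge0_le_integral => //.
  - by apply/measurable_EFinP; exact: measurable_indic.
  - apply/measurable_EFinP; apply: continuous_measurable_fun => x.
    apply: (@continuous_comp _ _ _ ( *%R c)); first exact: mulrl_continuous.
    exact: continuous_expR.
  move=> x _; rewrite lee_fin indicE.
  have [xD|_] := boolP (x \in D); last exact: expR_ge0.
  by rewrite -[leLHS]expR0 ler_expR; apply: Dc; rewrite inE in xD.
have [c0|c0] := leP 0 c.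
  exists `[0, +oo[%classic => //; split; first by rewrite lebesgue_measure_itv/= ltry.
  by move=> x; rewrite /= in_itv /= andbT => x0; exact: mulr_ge0.
exists `]-oo, 0]%classic => //; split; first by rewrite lebesgue_measure_itv/= ltNyr.
by move=> x; rewrite /= in_itv /= => x0; rewrite nmulr_rge0.
Qed.

End integral_rV.

(** * The divergence of the canonical velocity field *)

Section divergence_formula.
Context {R : realType} {n : nat}.
Local Notation V := 'rV[R]_n.

Lemma within_slice (S : topologicalType) (I : set R) (K : set V) (H : R -> V -> S) (t : R) :
  {within I `*` K, continuous (fun p : R * V => H p.1 p.2)} -> I t ->
  {within K, continuous (H t)}.
Proof.
move=> /subspace_continuousP cH It; apply/subspace_continuousP => x Kx.
move=> W HW; have [[A B] [/= tA xB] ABW] := cH (t, x) (conj It Kx) W HW.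
apply: filterS xB => y By Ky.
by apply: (ABW (t, y)); split=> //; exact: nbhs_singleton tA.
Qed.

Lemma continuous_coord (K : set V) (f : V -> V) (i : 'I_n) :
  {within K, continuous f} -> {within K, continuous (fun x => f x ord0 i)}.
Proof.
move=> cf x; apply: (@continuous_comp (subspace K) _ _ f (fun v : V => v ord0 i)).
  exact: cf.
exact: coord_continuous.
Qed.

Section smooth.
Variables (g : V -> R) (mu : probability (borel_rV R n) R) (K : set V).
Variables (T : R -> V -> V) (t : R).
Hypothesis gC1 : is_C1 g.
Hypothesis cK : compact K.
Hypothesis cT : {within K, continuous (T t)}.
Hypothesis cv : {within K, continuous (velocity T t)}.

Lemma continuous_translate (h : V -> R) (z : V) : continuous h ->
  {within K, continuous (fun x => h (z - T t x))}.
Proof.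
move=> ch x; apply: (@continuous_comp (subspace K) _ _ (T t) (fun w => h (z - w))).
  exact: cT.
apply: (@continuous_comp _ _ _ (fun w : V => z - w) h); last exact: ch.
apply: (@cvgB R V V (nbhs (T t x)) _ (cst z) id z (T t x)); last exact: cvg_id.
exact: (@cvg_cst V z V (nbhs (T t x))).
Qed.

Lemma smoothed_density_eq0 (z : V) :
  mu K = 0%E -> smoothed_density g mu K T t z = 0.
Proof.
move=> K0; rewrite /smoothed_density /Rintegral null_set_integral//.
  exact: compact_measurable_rV.
apply/measurable_EFinP; apply: within_continuous_measurable_rV => //.
exact: continuous_translate gC1.1.
Qed.

(** By compactness the integrand attains a positive minimum on [K]; this minimum times [mu K] bounds
    the integral from below. *)
Lemma smoothed_density_gt0 (z : V) : (forall x, 0 < g x) ->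
  mu K != 0%E -> 0 < smoothed_density g mu K T t z.
Proof.
move=> g0 K0; have cg := continuous_translate (z := z) gC1.1.
have [Ke|/set0P K_neq0] := eqVneq K set0; first by rewrite Ke measure0 eqxx in K0.
have [x0 _ minx0] := EVT_min_rV K_neq0 cK cg.
have mK := compact_measurable_rV cK.
apply: (@lt_le_trans _ _ (\int[mu]_(x in K) g (z - T t x0))).
  rewrite Rintegral_cst// mulr_gt0// fine_gt0//.
  by rewrite lt0e K0 measure_ge0/= ltey_eq fin_num_measure.
apply: le_Rintegral => //.
- apply: continuous_compact_integrable_rV => //.
  by apply: continuous_subspaceT; exact: cst_continuous.
- exact: continuous_compact_integrable_rV.
- by move=> x Kx; apply: minx0; rewrite inE.
Qed.

(** Quotient rule in each coordinate, numerator and denominator being differentiated under the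
    integral sign. *)
Lemma divergence_canonical_velocity (z : V) :
  (forall x, 0 < g x) -> mu K != 0%E ->
  divergence (canonical_velocity g mu K T t) z =
  (smoothed_density g mu K T t z) ^- 2 *
  \sum_(i < n) (smoothed_density g mu K T t z *
      \int[mu]_(x in K) (partial i g (z - T t x) * velocity T t x ord0 i)
    - \int[mu]_(x in K) (g (z - T t x) * velocity T t x ord0 i) *
      \int[mu]_(x in K) partial i g (z - T t x)).
Proof.
move=> g0 K0; rewrite /divergence mulr_sumr; apply: eq_bigr => i _.
have D0 := smoothed_density_gt0 z g0 K0.
set D := smoothed_density g mu K T t.
pose N (u : V) := \int[mu]_(x in K) (g (u - T t x) * velocity T t x ord0 i).
have dD : is_derive z (delta_mx ord0 i) D (\int[mu]_(x in K) partial i g (z - T t x)).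
  have := @is_derive_integral_translate R n mu K g (T t) (cst 1) i z gC1 cK cT.
  under [X in is_derive _ _ X]eq_fun do under eq_Rintegral do rewrite mulr1.
  under eq_Rintegral do rewrite mulr1.
  by apply; apply: continuous_subspaceT; exact: cst_continuous.
have dN : is_derive z (delta_mx ord0 i) N
    (\int[mu]_(x in K) (partial i g (z - T t x) * velocity T t x ord0 i)).
  by apply: is_derive_integral_translate => //; exact: continuous_coord.
have -> : (fun y => canonical_velocity g mu K T t y ord0 i) = (fun y => (D y)^-1) * N.
  by apply/funext => y; rewrite !mxE.
have Dz0 : D z != 0 by rewrite gt_eqF.
rewrite [LHS]/partial deriveM; [|exact: derivableV|exact: ex_derive].
rewrite deriveV// !derive_val /GRing.scale /= -/(N z).
by field.
Qed.

End smooth.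

End divergence_formula.

(** * Gaussian densities *)

Section gaussian_divergence.
Context {R : realType} {n : nat}.
Local Notation V := 'rV[R]_n.

Lemma enorm_ge0 (x : V) : 0 <= enorm x. Proof. exact: sqrtr_ge0. Qed.

Lemma enorm_sqr (x : V) : enorm x ^+ 2 = \sum_(i < n) x ord0 i ^+ 2.
Proof. by rewrite /enorm sqr_sqrtr// sumr_ge0// => j _; exact: sqr_ge0. Qed.

Lemma is_derive_lineP (f : V -> R) (z v : V) (df : R) :
  is_derive (0 : R) 1 (fun t => f (z + t *: v)) df -> is_derive z v f df.
Proof.
move=> [/cvg_ex[l fl] <-]; rewrite /derive (cvg_lim _ fl)//.
apply: derive_lineP; apply: cvg_trans fl; apply: near_eq_cvg.
by apply: nearW => t; rewrite /= /shift /= scaler1 addr0 scale0r addr0.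
Qed.

(** Along a coordinate line the squared distance to [a] is a quadratic polynomial in the parameter,
    so the one-variable chain rule suffices. *)
Lemma partial_gaussian (a : V) (s C : R) (i : 'I_n) (x : V) : 0 < s ->
  partial i (fun u : V => C * expR (- (enorm (u - a) ^+ 2 / (2 * s)))) x =
  - ((x - a) ord0 i / s) * (C * expR (- (enorm (x - a) ^+ 2 / (2 * s)))).
Proof.
move=> s0; pose e : V := delta_mx ord0 i; pose d := (x - a) ord0 i.
have line (h : R) : enorm (x + h *: e - a) ^+ 2 = enorm (x - a) ^+ 2 + h * (2 * d + h).
  rewrite !enorm_sqr (bigD1 i)//= [in RHS](bigD1 i)//= addrAC [RHS]addrAC; congr (_ + _).
    by rewrite /d /e !mxE !eqxx /=; ring.
  by apply: eq_bigr => j ji; rewrite /e !mxE (negbTE ji) andbF mulr0 addr0.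
suff [_ H] : is_derive x e (fun u : V => C * expR (- (enorm (u - a) ^+ 2 / (2 * s))))
    (- (d / s) * (C * expR (- (enorm (x - a) ^+ 2 / (2 * s))))) by exact: H.
apply: is_derive_lineP; under eq_fun do rewrite line.
(* [P] is the exponent along the line, expanded in powers of the parameter; only its linear
   coefficient matters for the derivative at 0. *)
pose P : R -> R := cst (- (enorm (x - a) ^+ 2 / (2 * s))) + (- (d / s)) \*: id +
  (- (2 * s)^-1) \*: (id ^+ 2).
have dP : is_derive (0 : R) 1 P (- (d / s)).
  by apply: is_derive_eq; rewrite add0r /GRing.scale /= expr1 !mulr0 !mul0r !mulr0 addr0 mulr1.
have -> : (fun h => C * expR (- ((enorm (x - a) ^+ 2 + h * (2 * d + h)) / (2 * s)))) =
    C \*: (expR \o P).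
  apply/funext => h; rewrite /= /GRing.scale /=; congr (_ * expR _).
  rewrite /P /= !fctE /= /GRing.scale /=.
  by field; rewrite gt_eqF.
have P0 : P 0 = - (enorm (x - a) ^+ 2 / (2 * s)).
  by rewrite /P !fctE /= /GRing.scale /=; ring.
by apply: is_derive_eq; rewrite P0 /GRing.scale /=; ring.
Qed.

(** Each [t] in [[0, 1]], endpoints included, is an accumulation point of the interval. Hence the
    limit defining [velocity] is unique and preserves inequalities. *)
Lemma within_cvg_proper (t : R) : 0 <= t <= 1 ->
  ProperFilter (within `[0, 1] (t^')).
Proof.
move=> /andP[t0 t1]; apply: Build_ProperFilter => /nbhs_ballP[e /= e0 tP].
(* A displacement of at most one half stays in [[0, 1]] when taken to the right for [t <= 1/2] and
   to the left otherwise. *)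
pose m := Num.min (e / 2) 2^-1.
have m0 : 0 < m by rewrite lt_min divr_gt0//= invr_gt0.
have me : m < e by rewrite /m gt_min; apply/orP; left; lra.
have m2 : m <= 2^-1 by rewrite /m ge_min lexx orbT.
have [|] := leP t 2^-1 => th.
  apply: (tP (t + m)); rewrite /= ?in_itv /=.
  - by rewrite /ball /= opprD addNKr normrN gtr0_norm.
  - by rewrite -subr_eq0 addrAC subrr add0r gt_eqF.
  - by apply/andP; split; lra.
apply: (tP (t - m)); rewrite /= ?in_itv /=.
- by rewrite /ball /= opprB addrC subrK gtr0_norm.
- by rewrite -subr_eq0 addrAC subrr add0r oppr_eq0 gt_eqF.
- by apply/andP; split; lra.
Qed.

Lemma Rintegral_sum_continuous (mu : {finite_measure set (borel_rV R n) -> \bar R})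
    (K : set V) (I : Type) (r : seq I) (c : I -> V -> R) : compact K ->
  (forall i, {within K, continuous (c i)}) ->
  {within K, continuous (fun x => \sum_(i <- r) c i x)} /\
  \int[mu]_(x in K) (\sum_(i <- r) c i x) = \sum_(i <- r) \int[mu]_(x in K) c i x.
Proof.
move=> cK cc; elim: r => [|i r [IHc IH]].
  split.
    under eq_fun do rewrite big_nil.
    by apply: continuous_subspaceT; exact: cst_continuous.
  under eq_Rintegral do rewrite big_nil.
  by rewrite big_nil Rintegral_cst ?mul0r//; exact: compact_measurable_rV.
split.
  by under eq_fun do rewrite big_cons; move=> x; apply: cvgD; [exact: cc|exact: IHc].
under eq_Rintegral do rewrite big_cons.
rewrite big_cons RintegralD ?IH//; last 2 first.
- exact: continuous_compact_integrable_rV.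
- exact: continuous_compact_integrable_rV.
exact: compact_measurable_rV.
Qed.

(* Symmetrised form of Chebyshev's inequality; integrating first in [x] and then
   in [x'] makes Fubini's theorem unnecessary. *)
Lemma covariance_le0 (mu : {finite_measure set (borel_rV R n) -> \bar R})
    (K : set V) (G : V -> R) (y v : 'I_n -> V -> R) : compact K ->
  {within K, continuous G} -> (forall x, K x -> 0 <= G x) ->
  (forall i, {within K, continuous (y i)}) ->
  (forall i, {within K, continuous (v i)}) ->
  (forall x x', K x -> K x' -> \sum_(i < n) (y i x - y i x') * (v i x - v i x') <= 0) ->
  \sum_(i < n) ((\int[mu]_(x in K) G x) * (\int[mu]_(x in K) (G x * (y i x * v i x)))
    - (\int[mu]_(x in K) (G x * y i x)) * (\int[mu]_(x in K) (G x * v i x))) <= 0.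
Proof.
move=> cK cG G0 cy cv yv0.
have mK := compact_measurable_rV cK.
have int (f : V -> R) : {within K, continuous f} -> mu.-integrable K (EFin \o f).
  exact: continuous_compact_integrable_rV.
pose E (c : V -> R) := \int[mu]_(x in K) (G x * c x).
have cM (f h : V -> R) : {within K, continuous f} -> {within K, continuous h} ->
    {within K, continuous (fun x => f x * h x)}.
  by move=> cf ch x; apply: cvgM; [exact: cf|exact: ch].
have cD (f h : V -> R) : {within K, continuous f} -> {within K, continuous h} ->
    {within K, continuous (fun x => f x + h x)}.
  by move=> cf ch x; apply: cvgD; [exact: cf|exact: ch].
have cst_c (k : R) : {within K, continuous (fun=> k)}.
  by apply: continuous_subspaceT; exact: cst_continuous.
(* This family is stable under the argument: the product of increments of [y i] and [v i] between
   [x] and [x'] has this form in [x], and its weighted integral over [x] has this form in [x']. *)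
pose L (i : 'I_n) (p q r k : R) (x : V) :=
  p * (y i x * v i x) + q * y i x + r * v i x + k.
have ED (f h : V -> R) : {within K, continuous f} -> {within K, continuous h} ->
    E (fun x => f x + h x) = E f + E h.
  move=> cf ch; have If := int _ (cM _ _ cG cf); have Ih := int _ (cM _ _ cG ch).
  by rewrite /E -RintegralD//; apply: eq_Rintegral => x _; exact: mulrDr.
have EZ (k : R) (f : V -> R) : {within K, continuous f} -> E (fun x => k * f x) = k * E f.
  move=> cf; have If := int _ (cM _ _ cG cf).
  by rewrite /E -RintegralZl//; apply: eq_Rintegral => x _; exact: mulrCA.
have cL i p q r k : {within K, continuous (L i p q r k)}.
  exact: (cD _ _ (cD _ _ (cD _ _ (cM _ _ (cst_c p) (cM _ _ (cy i) (cv i)))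
    (cM _ _ (cst_c q) (cy i))) (cM _ _ (cst_c r) (cv i))) (cst_c k)).
have EL i p q r k : E (L i p q r k) =
    p * E (fun x => y i x * v i x) + q * E (y i) + r * E (v i) + k * E (cst 1).
  have c1 := cM _ _ (cst_c p) (cM _ _ (cy i) (cv i)).
  have c2 := cM _ _ (cst_c q) (cy i); have c3 := cM _ _ (cst_c r) (cv i).
  rewrite /L (ED _ _ (cD _ _ (cD _ _ c1 c2) c3) (cst_c k)) (ED _ _ (cD _ _ c1 c2) c3).
  rewrite (ED _ _ c1 c2) (EZ _ _ (cM _ _ (cy i) (cv i))) (EZ _ _ (cy i)) (EZ _ _ (cv i)).
  congr (_ + _); rewrite -(EZ _ _ (cst_c 1)).
  by apply: eq_Rintegral => x _; rewrite /= mulr1.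
have Ele0 (c : V -> R) : {within K, continuous c} -> (forall x, K x -> c x <= 0) -> E c <= 0.
  move=> cc c0; have -> : 0 = \int[mu]_(x in K) (0 : R) by rewrite Rintegral_cst ?mul0r.
  apply: le_Rintegral => //; [exact: int (cM _ _ cG cc)|exact: int|].
  by move=> x Kx; rewrite mulr_ge0_le0 ?G0 ?c0.
have Esum (c : 'I_n -> V -> R) : (forall i, {within K, continuous (c i)}) ->
    {within K, continuous (fun x => \sum_(i < n) c i x)} /\
    E (fun x => \sum_(i < n) c i x) = \sum_(i < n) E (c i).
  move=> cc; split.
    by have [] := Rintegral_sum_continuous mu (index_enum 'I_n) cK cc.
  rewrite /E; under eq_Rintegral do rewrite mulr_sumr.
  have cGc : forall j, {within K, continuous (fun x => G x * c j x)} by move=> j; exact: cM.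
  by have [_ ->] := Rintegral_sum_continuous mu (index_enum 'I_n) cK cGc.
(* [Phi x'] is the weighted integral over [x] of the sum of products of increments, already
   evaluated in terms of moments. *)
pose Phi (x' : V) := \sum_(i < n) L i (E (cst 1)) (- E (v i)) (- E (y i))
  (E (fun x => y i x * v i x)) x'.
have Phi_le0 x' : K x' -> Phi x' <= 0.
  move=> Kx'; rewrite /Phi.
  have <- : E (fun x => \sum_(i < n) L i 1 (- v i x') (- y i x') (y i x' * v i x') x) =
      \sum_(i < n) L i (E (cst 1)) (- E (v i)) (- E (y i)) (E (fun x => y i x * v i x)) x'.
    have [_ ->] := Esum _ (fun j => cL j 1 (- v j x') (- y j x') (y j x' * v j x')).
    by apply: eq_bigr => j _; rewrite EL /L; ring.
  apply: Ele0.
    by have [] := Esum _ (fun j => cL j 1 (- v j x') (- y j x') (y j x' * v j x')).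
  move=> x Kx; apply: le_trans (yv0 x x' Kx Kx'); rewrite le_eqVlt; apply/orP; left.
  by apply/eqP/eq_bigr => j _; rewrite /L; ring.
have [cPhi EPhiE] := Esum _ (fun j => cL j (E (cst 1)) (- E (v j)) (- E (y j))
  (E (fun x => y j x * v j x))).
have EPhi : E Phi <= 0 by exact: Ele0.
rewrite EPhiE in EPhi.
have E1 : E (cst 1) = \int[mu]_(x in K) G x by apply: eq_Rintegral => x _; rewrite /= mulr1.
(* Integrating [Phi] produces each of the two products of moments twice, hence the factor 2. *)
rewrite -(@pmulr_rle0 _ 2)// mulr_sumr; apply: le_trans EPhi.
rewrite le_eqVlt; apply/orP; left; apply/eqP/eq_bigr => j _.
by rewrite EL -E1 -/(E (y j)) -/(E (v j)) -/(E (fun x => y j x * v j x)); ring.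
Qed.

End gaussian_divergence.

(** * Monotonicity of contraction velocities and the divergence inequality for Gaussians *)

Section contraction_divergence.
Context {R : realType} {n : nat}.
Local Notation V := 'rV[R]_n.

Lemma cvg_sumr (T I : Type) (F : set_system T) (FF : Filter F) (r : seq I)
    (f : I -> T -> R) (l : I -> R) : (forall i, f i @ F --> l i) ->
  (fun x => \sum_(i <- r) f i x) @ F --> \sum_(i <- r) l i.
Proof.
move=> fl; elim: r => [|i r IH].
  by under eq_fun do rewrite big_nil; rewrite big_nil; exact: cvg_cst.
by under eq_fun do rewrite big_cons; rewrite big_cons; apply: cvgD; first exact: fl.
Qed.

(** The difference quotient in time of the squared distance between the two trajectories is
    nonpositive on either side of [t], and it tends to twice the sum. The one-sided limits at 0 and
    1 therefore need no separate treatment. *)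
Lemma contraction_velocity_le0 (K : set V) (T : R -> V -> V) (t : R) (x x' : V) :
  smooth_contraction K T -> 0 <= t <= 1 -> K x -> K x' ->
  \sum_(i < n) (T t x ord0 i - T t x' ord0 i) *
    (velocity T t x ord0 i - velocity T t x' ord0 i) <= 0.
Proof.
move=> [[_ _ Tle] Tder _] t01 Kx Kx'.
have FF := within_cvg_proper t01; set F := within _ _ in FF.
have cq (y : V) (i : 'I_n) : K y ->
    (fun s => trajectory_quotient T t y s ord0 i) @ F --> velocity T t y ord0 i.
  move=> Ky; have /cvg_ex[l cl] := Tder y Ky t t01.
  have -> : velocity T t y = l by exact: cvg_lim cl.
  apply: (@continuous_cvg _ _ _ F FF (trajectory_quotient T t y) (fun v : V => v ord0 i)) => //.
  exact: coord_continuous.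
pose q i s := trajectory_quotient T t x s ord0 i - trajectory_quotient T t x' s ord0 i.
pose D i := T t x ord0 i - T t x' ord0 i.
pose W i := velocity T t x ord0 i - velocity T t x' ord0 i.
have cqi i : q i @ F --> W i by apply: cvgB; exact: cq.
have cst0 : (fun s : R => s - t) @ F --> (0 : R).
  rewrite -(subrr t); apply: cvgB; last exact: cvg_cst.
  by apply: cvg_within_filter; exact: cvg_within.
(* Since the two trajectories at time [s] differ by [D + (s - t) q], the sum on the left is exactly
   the difference quotient of the squared distance. Its limit follows from that of [q] by algebra
   alone. *)
have cphi : (fun s => \sum_(i < n) (2 * D i + (s - t) * q i s) * q i s) @ F -->
    \sum_(i < n) (2 * D i + 0 * W i) * W i.
  apply: cvg_sumr => i.
  by apply: cvgM => //; apply: cvgD; [exact: cvg_cst|exact: cvgM].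
rewrite -(@pmulr_rle0 _ 2)// mulr_sumr.
have -> : \sum_(i < n) 2 * (D i * W i) = \sum_(i < n) (2 * D i + 0 * W i) * W i.
  by apply: eq_bigr => i _; rewrite mul0r addr0 mulrA.
apply: (cvgr_to_le cphi).
have : F [set s | s != t /\ 0 <= s <= 1].
  suff : nbhs t (fun s => s != t -> `[0, 1]%classic s -> s != t /\ 0 <= s <= 1) by [].
  apply: (@filterE R (nbhs t) (nbhs_filter t)) => s st s01.
  by split => //; move: s01; rewrite /= in_itv.
apply: filterS => s [st /andP[s0 s1]].
have [t0 t1] := andP t01.
have phiE : (s - t) * (\sum_(i < n) (2 * D i + (s - t) * q i s) * q i s) =
    enorm (T s x - T s x') ^+ 2 - enorm (T t x - T t x') ^+ 2.
  rewrite !enorm_sqr -sumrB mulr_sumr; apply: eq_bigr => i _.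
  have -> : q i s = (s - t)^-1 * (T s x ord0 i - T s x' ord0 i - D i).
    by rewrite /q /trajectory_quotient /D !mxE; ring.
  by rewrite /D !mxE; field; rewrite subr_eq0.
have [ts|ts] := ltP t s.
  rewrite -(@pmulr_rle0 _ (s - t)) ?subr_gt0// phiE subr_le0
    ler_pXn2r// ?nnegrE ?enorm_ge0//.
  by apply: Tle => //; exact: ltW.
have {ts}ts : s < t by rewrite lt_neqAle st.
rewrite -(@nmulr_rge0 _ (s - t)) ?subr_lt0// phiE subr_ge0
  ler_pXn2r// ?nnegrE ?enorm_ge0//.
by apply: Tle => //; exact: ltW.
Qed.

Lemma gaussian_divergence_le0 (g : V -> R) (mu : probability (borel_rV R n) R) (K : set V)
    (T : R -> V -> V) (t : R) (z : V) :
  is_isotropic_gaussian g -> is_C1 g -> (forall x, 0 < g x) ->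
  compact K -> smooth_contraction K T -> 0 <= t <= 1 ->
  divergence (canonical_velocity g mu K T t) z <= 0.
Proof.
move=> [a [s [s0 gE]]] gC1 g0 cK sT t01.
have tI : `[0, 1]%classic t by rewrite /= in_itv.
have cT : {within K, continuous (T t)}.
  exact: (within_slice (contraction_homotopy (smooth_contraction_contraction sT)) tI).
have cv : {within K, continuous (velocity T t)}.
  exact: (within_slice (smooth_contraction_velocity sT) tI).
have mK := compact_measurable_rV cK.
(* If [mu K = 0], the smoothed density vanishes identically and the convention [0^-1 = 0] makes the
   canonical velocity the zero field. *)
have [K0|K0] := eqVneq (mu K) 0%E.
  have -> : canonical_velocity g mu K T t = cst 0.
    by apply/funext => u; rewrite /canonical_velocity smoothed_density_eq0// invr0 scale0r.
  rewrite /divergence big1// => i _; rewrite /partial.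
  by under eq_fun do rewrite mxE; exact: derive_cst.
rewrite divergence_canonical_velocity//.
have ggE : g = fun u => (2 * pi * s) `^ (- (n%:R / 2)) *
    expR (- (enorm (u - a) ^+ 2 / (2 * s))).
  exact/funext.
have dg i u : partial i g u = - ((u - a) ord0 i / s) * g u by rewrite ggE partial_gaussian.
rewrite mulr_ge0_le0// ?exprn_ge0 ?invr_ge0 ?exprn_ge0//.
  exact/ltW/smoothed_density_gt0.
pose G x := g (z - T t x).
have cG : {within K, continuous G} by exact: continuous_translate gC1.1.
pose y i (x : V) := T t x ord0 i.
pose v i (x : V) := velocity T t x ord0 i.
have cy i : {within K, continuous (y i)} by exact: continuous_coord.
have cv' i : {within K, continuous (v i)} by exact: continuous_coord.
have := covariance_le0 mu cK cG (fun x _ => ltW (g0 _)) cy cv'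
  (fun x x' Kx Kx' => contraction_velocity_le0 sT t01 Kx Kx').
rewrite -(pmulr_rle0 _ s0) mulr_sumr; apply: le_trans.
rewrite le_eqVlt; apply/orP; left; apply/eqP/eq_bigr => i _.
have cM (f h : V -> R) : {within K, continuous f} -> {within K, continuous h} ->
    {within K, continuous (fun x => f x * h x)}.
  by move=> cf ch x; apply: cvgM; [exact: cf|exact: ch].
have int (f : V -> R) : {within K, continuous f} -> mu.-integrable K (EFin \o f).
  exact: continuous_compact_integrable_rV.
have cst_c (k : R) : {within K, continuous (fun=> k)}.
  by apply: continuous_subspaceT; exact: cst_continuous.
(* At [z - T t x] the [i]-th score coordinate of the Gaussian is [y i x / s - b]. The terms with the
   constant [b] cancel between the two products, leaving a weighted covariance of [y i] and [v i]
   divided by [s]. *)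
pose b := (z - a) ord0 i / s.
have -> : \int[mu]_(x in K) (partial i g (z - T t x) * velocity T t x ord0 i) =
    s^-1 * (\int[mu]_(x in K) (G x * (y i x * v i x))) -
    b * \int[mu]_(x in K) (G x * v i x).
  have c1 := cM _ _ cG (cM _ _ (cy i) (cv' i)); have c2 := cM _ _ cG (cv' i).
  have I1 := int _ c1; have I2 := int _ c2.
  rewrite -!RintegralZl// -RintegralB//;
    [|exact: int (cM _ _ (cst_c _) c1)|exact: int (cM _ _ (cst_c _) c2)].
  by apply: eq_Rintegral => x _; rewrite dg /b /G /y /v !mxE; ring.
have -> : \int[mu]_(x in K) partial i g (z - T t x) =
    s^-1 * (\int[mu]_(x in K) (G x * y i x)) - b * \int[mu]_(x in K) G x.
  have c1 := cM _ _ cG (cy i).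
  have I1 := int _ c1; have I2 := int _ cG.
  rewrite -!RintegralZl// -RintegralB//;
    [|exact: int (cM _ _ (cst_c _) c1)|exact: int (cM _ _ (cst_c _) cG)].
  by apply: eq_Rintegral => x _; rewrite dg /b /G /y /v !mxE; ring.
rewrite -/(G _) -/(v i _) /smoothed_density -/G.
by rewrite /v /G; field; rewrite gt_eqF.
Qed.

End contraction_divergence.

(** * Two-point tests *)

Section two_point_probability.
Context {R : realType} {n : nat}.
Local Notation V := 'rV[R]_n.
Variables p q : V.

Definition two_point : set (borel_rV R n) -> \bar R :=
  mscale (2^-1)%:nng (measure_add (@dirac _ (borel_rV R n) p R)
    (@dirac _ (borel_rV R n) q R)).

HB.instance Definition _ := Measure.on two_point.

Lemma two_pointE (A : set (borel_rV R n)) :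
  two_point A = (2^-1%:E * (\d_(p : borel_rV R n) A + \d_(q : borel_rV R n) A))%E.
Proof. by rewrite -measure_addE. Qed.

Let two_point_setT : two_point setT = 1%E.
Proof. by rewrite two_pointE !diracT -EFinD -EFinM mulVf. Qed.

HB.instance Definition _ := Measure_isProbability.Build _ _ _ two_point two_point_setT.

Lemma compact_pair : compact [set p; q].
Proof. by apply: compactU; exact: compact_set1. Qed.

Lemma msupport_two_point : msupport two_point `<=` [set p; q].
Proof.
move=> x /(_ (~` [set p; q])) x_supp; apply: contrapT => nx.
have oK : open (~` [set p; q]).
  by apply: closed_openC; apply: compact_closed compact_pair; exact: (@norm_hausdorff R V).
have := x_supp oK nx; rewrite two_pointE !diracE !memNset ?adde0 ?mule0 ?ltxx//.
  by apply; right.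
by apply; left.
Qed.

Lemma Rintegral_two_point (f : V -> R) : p != q -> {within [set p; q], continuous f} ->
  \int[two_point]_(x in [set p; q]) f x = (f p + f q) / 2.
Proof.
move=> pq cf.
have m1 (x : V) : measurable ([set x] : set (borel_rV R n)).
  by apply: compact_measurable_rV; exact: compact_set1.
have cst1 (x : V) : \int[two_point]_(y in [set x]) f y = \int[two_point]_(y in [set x]) f x.
  by apply: eq_Rintegral => y; rewrite inE => ->.
rewrite Rintegral_setU//; last 2 first.
- by apply: continuous_compact_integrable_rV => //; exact: compact_pair.
- by apply/disj_setPS => x [-> /eqP]; rewrite (negbTE pq).
have in1 (x y : V) : (x \in [set y]) = (x == y) by apply/idP/eqP; rewrite inE.
rewrite !cst1 !Rintegral_cst//= !two_pointE !diracE !in1 !eqxx eq_sym (negbTE pq) /=.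
by rewrite !addr0 !add0r !mulr1; field.
Qed.

End two_point_probability.

(** * Inner products, duality for a half-space, and maps with parallel increments *)

Section dot_product.
Context {R : realType} {n : nat}.
Local Notation V := 'rV[R]_n.

Definition dotr (u v : V) : R := \sum_(i < n) u ord0 i * v ord0 i.

Lemma dotrC u v : dotr u v = dotr v u.
Proof. by apply: eq_bigr => i _; rewrite mulrC. Qed.

Lemma dotrDl u v w : dotr (u + v) w = dotr u w + dotr v w.
Proof. by rewrite -big_split; apply: eq_bigr => i _; rewrite mxE mulrDl. Qed.

Lemma dotrZl a u w : dotr (a *: u) w = a * dotr u w.
Proof. by rewrite mulr_sumr; apply: eq_bigr => i _; rewrite mxE mulrA. Qed.

Lemma dotrDr u v w : dotr w (u + v) = dotr w u + dotr w v.
Proof. by rewrite !(dotrC w) dotrDl. Qed.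

Lemma dotrZr a u w : dotr w (a *: u) = a * dotr w u.
Proof. by rewrite !(dotrC w) dotrZl. Qed.

Lemma dotr_ge0 u : 0 <= dotr u u.
Proof. by apply: sumr_ge0 => i _; rewrite -expr2 sqr_ge0. Qed.

Lemma dotr_eq0 u : (dotr u u == 0) = (u == 0).
Proof.
apply/idP/eqP => [|->]; last by rewrite -(scale0r 0) dotrZl mul0r.
rewrite psumr_eq0 => [/allP u0|i _]; last by rewrite -expr2 sqr_ge0.
apply/rowP => i; rewrite mxE; apply/eqP.
by have := u0 i (mem_index_enum i); rewrite /= mulf_eq0 orbb.
Qed.

Lemma dotr_gt0 u : u != 0 -> 0 < dotr u u.
Proof. by move=> u0; rewrite lt0r dotr_eq0 u0 dotr_ge0. Qed.

(** Let [r] be the component of [G] orthogonal to [d]. Testing [w = - d] gives the sign of the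
    coefficient along [d]; testing [r] pushed slightly into the open half-space forces [r = 0]. *)
Lemma half_space_dual (d G : V) : d != 0 ->
  (forall w, dotr d w < 0 -> dotr G w <= 0) ->
  exists2 l : R, 0 <= l & G = l *: d.
Proof.
move=> d0 dG; have dd := dotr_gt0 d0.
have Gd : 0 <= dotr G d.
  have := dG (-1 *: d); rewrite !dotrZr !mulN1r oppr_lt0 oppr_le0; exact.
pose l := dotr G d / dotr d d; exists l; first by rewrite divr_ge0 ?dotr_ge0.
pose r := G - l *: d.
have rd : dotr r d = 0.
  by rewrite /r -scaleNr dotrDl dotrZl /l mulNr divfK ?subrr// gt_eqF.
have GE : G = r + l *: d by rewrite /r subrK.
suff r0 : dotr r r <= 0.
  have /eqP : dotr r r == 0 by rewrite eq_le r0 dotr_ge0.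
  by move/eqP; rewrite dotr_eq0 => /eqP r_eq0; rewrite GE r_eq0 add0r.
clearbody r; rewrite leNgt; apply/negP => rr.
(* This size keeps [e * dotr G d] strictly below [dotr r r], so the test vector [r - e *: d]
   violates the hypothesis; the added 1 covers [dotr G d = 0]. *)
pose e := dotr r r / (2 * (dotr G d + 1)).
have e0 : 0 < e by rewrite divr_gt0// mulr_gt0// ltr_wpDl.
have := dG (r + (- e) *: d).
rewrite !dotrDr !dotrZr (dotrC d r) rd add0r mulNr oppr_lt0 mulr_gt0// => /(_ isT).
have -> : dotr G r = dotr r r by rewrite {1}GE dotrDl dotrZl (dotrC d) rd mulr0 addr0.
rewrite mulNr subr_le0; apply/negP; rewrite -ltNge /e.
rewrite -mulrA gtr_pMr// mulrC ltr_pdivrMr ?mul1r; last by rewrite mulr_gt0// ltr_wpDl.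
lra.
Qed.

(** Comparison with the origin gives a slope [l u] for each [u]. Comparing two linearly independent
    vectors shows that their slopes agree, and in dimension at least 2 all nonzero vectors are
    linked through coordinate vectors. *)
Lemma parallel_increments_affine (F : V -> V) : (2 <= n)%N ->
  (forall u v, u != v -> exists l : R, F u - F v = l *: (u - v)) ->
  exists l : R, forall u, F u = F 0 + l *: u.
Proof.
move=> n2 Fpar.
have /choice[l lP] : forall u, exists l : R, F u = F 0 + l *: u.
  move=> u; have [->|u0] := eqVneq u 0; first by exists 0; rewrite scale0r addr0.
  have [k] := Fpar u 0 u0; rewrite subr0 => kE; exists k.
  by rewrite -kE addrC subrK.
(* A nonzero 2 by 2 minor expresses linear independence. The relation
   [(l u - m) *: u = (l v - m) *: v] then makes both coefficients vanish. *)
have indep (u v : V) (i j : 'I_n) : u ord0 i * v ord0 j - u ord0 j * v ord0 i != 0 -> l u = l v.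
  move=> uv.
  have unv : u != v by apply: contra_neq uv => ->; rewrite mulrC subrr.
  have [m] := Fpar u v unv; rewrite [F u]lP [F v]lP opprD addrACA subrr add0r => mE.
  have E k : (l u - m) * u ord0 k = (l v - m) * v ord0 k.
    by move/rowP/(_ k) : mE; rewrite !mxE => mE; lra.
  have := E i; have := E j => Ej Ei.
  have lum : (l u - m) * (u ord0 i * v ord0 j - u ord0 j * v ord0 i) = 0.
    by rewrite mulrBr !mulrA Ei Ej; ring.
  have lvm : (l v - m) * (u ord0 i * v ord0 j - u ord0 j * v ord0 i) = 0.
    by rewrite mulrBr ![_ * (u _ _ * _)]mulrCA -Ei -Ej; ring.
  move/eqP: lum; rewrite mulf_eq0 (negbTE uv) orbF subr_eq0 => /eqP ->.
  by move/eqP: lvm; rewrite mulf_eq0 (negbTE uv) orbF subr_eq0 => /eqP ->.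
pose i0 := Ordinal (ltnW n2); pose i1 := Ordinal n2.
pose e (i : 'I_n) : V := delta_mx ord0 i.
have le (u : V) (i j : 'I_n) : i != j -> u ord0 j != 0 -> l u = l (e i).
  move=> ij uj; apply: (indep _ _ j i); rewrite /e !mxE !eqxx /=.
  by rewrite [j == i]eq_sym (negbTE ij) mulr0 subr0 mulr1.
have l01 : l (e i1) = l (e i0) by apply: (le _ _ i1) => //; rewrite mxE !eqxx oner_neq0.
exists (l (e i0)) => u; have [->|u0] := eqVneq u 0; first by rewrite scaler0 addr0.
suff [j uj] : exists j, u ord0 j != 0.
  (* If the known nonzero coordinate of [u] is the one at [i0], the comparison goes through [e i1]
     instead of [e i0]. *)
  rewrite lP; congr (_ + _ *: _); have [ji|ji] := eqVneq i0 j; last exact: le ji uj.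
  by rewrite -l01; apply: (le _ _ j) => //; rewrite -ji.
apply/existsP; apply: contraNT u0; rewrite negb_exists => /forallP u0.
by apply/eqP/rowP => j; rewrite mxE; apply/eqP; have := u0 j; rewrite negbK.
Qed.

End dot_product.

(** * Smooth contractions moving one of two points along a segment *)

Section contraction_test.
Context {R : realType} {n : nat}.
Local Notation V := 'rV[R]_n.

Lemma continuous_dotr (w : V) : continuous (fun x : V => dotr x w).
Proof.
move=> x; apply: (@cvg_sumr R V 'I_n (nbhs x) (nbhs_filter x)) => i.
apply: cvgM; last exact: cvg_cst.
exact: coord_continuous.
Qed.

Lemma enormE (x : V) : enorm x = Num.sqrt (dotr x x).
Proof. by congr Num.sqrt; apply: eq_bigr => i _; rewrite expr2. Qed.

Section approach.
Variables p q w : V.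
Hypothesis pq : p != q.
Hypothesis pqw : dotr w w <= - dotr (p - q) w.

(* [chi] is an affine cutoff with [chi p = 1] and [chi q = 0], so that
   [approach] moves [p] along [w] and fixes [q]. *)
Let chi (x : V) : R := dotr (x - q) (p - q) / dotr (p - q) (p - q).

Definition approach (s : R) (x : V) : V := x + (s * chi x) *: w.

Let chi_p : chi p = 1.
Proof. by rewrite /chi divff// dotr_eq0 subr_eq0. Qed.

Let chi_q : chi q = 0.
Proof. by rewrite /chi subrr -(scale0r 0) dotrZl !mul0r. Qed.

Let continuous_chi : continuous chi.
Proof.
have -> : chi = fun x => (dotr x (p - q) + dotr (- q) (p - q)) * (dotr (p - q) (p - q))^-1.
  by apply/funext => x; rewrite /chi dotrDl.
move=> x; apply: (@cvgM _ _ (nbhs x)); last exact: (@cvg_cst R _ V (nbhs x)).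
apply: (@cvgD _ _ _ (nbhs x)); last exact: (@cvg_cst R _ V (nbhs x)).
exact: continuous_dotr.
Qed.

Let cvg_approach (t : R) (x : V) :
  trajectory_quotient approach t x @ within `[0, 1] t^' --> chi x *: w.
Proof.
have FF : Filter (within `[0, 1] t^') by exact: within_filter.
apply: cvg_trans (@cvg_cst V (chi x *: w) R _ FF); apply: near_eq_cvg.
suff : nbhs t (fun s => s != t -> `[0, 1]%classic s ->
    chi x *: w = trajectory_quotient approach t x s) by [].
apply: (@filterE R (nbhs t) (nbhs_filter t)) => s st _.
rewrite /trajectory_quotient /approach opprD addrACA subrr add0r -scalerBl scalerA.
by congr (_ *: _); field; rewrite subr_eq0.
Qed.

Lemma velocity_approach (t : R) (x : V) : 0 <= t <= 1 ->
  velocity approach t x = chi x *: w.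
Proof.
move=> t01; have FF := within_cvg_proper t01.
by apply: cvg_lim; [exact: (@norm_hausdorff R V)|exact: cvg_approach].
Qed.

Lemma velocity_approach_p : velocity approach 0 p = w.
Proof. by rewrite velocity_approach ?lexx ?ler01// chi_p scale1r. Qed.

Lemma velocity_approach_q : velocity approach 0 q = 0.
Proof. by rewrite velocity_approach ?lexx ?ler01// chi_q scale0r. Qed.

Lemma approach0 (x : V) : approach 0 x = x.
Proof. by rewrite /approach mul0r scale0r addr0. Qed.

(** The separation at time [r] is [p - q + r *: w]; half the derivative of its squared norm is
    [dotr (p - q) w + r * dotr w w], which [pqw] makes nonpositive up to [r = 1]. *)
Lemma smooth_contraction_approach : smooth_contraction [set p; q] approach.
Proof.
have cscale : continuous (fun z : R * V => chi z.2 *: w).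
  move=> z; apply: cvgZ; last exact: cvg_cst.
  by apply: (@continuous_comp _ _ _ snd chi); [exact: cvg_snd|exact: continuous_chi].
split; first split.
- apply: continuous_subspaceT => z.
  apply: cvgD; first exact: cvg_snd.
  apply: cvgZ; last exact: cvg_cst.
  apply: cvgM; first exact: cvg_fst.
  by apply: (@continuous_comp _ _ _ snd chi); [exact: cvg_snd|exact: continuous_chi].
- by move=> x _; exact: approach0.
- have pq_le s t : 0 <= s -> s <= t -> t <= 1 ->
      enorm (approach t p - approach t q) <= enorm (approach s p - approach s q).
    move=> s0 st t1.
    have E r : approach r p - approach r q = (p - q) + r *: w.
      by rewrite /approach chi_p chi_q mulr1 mulr0 scale0r addr0 addrAC.
    rewrite !E !enormE ler_wsqrtr//; move: pqw; move: (p - q) => d.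
    have := dotr_ge0 w.
    rewrite !dotrDl !dotrDr !dotrZl !dotrZr (dotrC w d).
    move: (dotr d w) (dotr w w) (dotr d d) => dw ww dd ww0 wd.
    (* This product is the decrease of the squared distance from time [s] to time [t]; its second
       factor is nonnegative because [t + s <= 2]. *)
    have : 0 <= (t - s) * (- 2 * dw - (t + s) * ww).
      by rewrite mulr_ge0 ?subr_ge0//; nra.
    nra.
  have enormN (u v : V) : enorm (u - v) = enorm (v - u).
    by rewrite !enormE -opprB -scaleN1r dotrZl dotrZr mulrA mulrNN !mulr1 mul1r.
  move=> x y [->|->] [->|->] s t s0 st t1; rewrite ?subrr//; first exact: pq_le.
  by rewrite enormN [leRHS]enormN; exact: pq_le.
- by move=> x _ t _; apply/cvg_ex; exists (chi x *: w); exact: cvg_approach.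
- apply: (@subspace_eq_continuous _ _ _ (fun z : R * V => chi z.2 *: w)).
    move=> [t x]; rewrite inE => -[/= tI _].
    have t01 : 0 <= t <= 1 by move: tI; rewrite in_itv.
    exact: esym (velocity_approach x t01).
  exact: continuous_subspaceT.
Qed.

End approach.

End contraction_test.

(** * Rigidity *)

Section rigidity.
Context {R : realType} {n : nat}.
Local Notation V := 'rV[R]_n.

Definition contraction_divergence_le0 (g : V -> R) : Prop :=
  forall (mu : probability (borel_rV R n) R) (K : set V) (T : R -> V -> V),
    compact K -> msupport mu `<=` K -> smooth_contraction K T ->
    forall (t : R) (z : V), 0 <= t <= 1 ->
      divergence (canonical_velocity g mu K T t) z <= 0.

Definition grad (g : V -> R) (x : V) : V := \row_i partial i g x.

(** The divergence is evaluated at time 0 and [z = 0] for the measure with mass 1/2 at [p] and at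
    [q]. Only [p] moves, so the velocity integrals reduce to their terms at [p]. *)
Lemma two_point_test (g : V -> R) (p q w : V) :
  contraction_divergence_le0 g -> is_C1 g -> (forall x, 0 < g x) ->
  p != q -> dotr w w <= - dotr (p - q) w ->
  dotr (grad g (- p)) w * g (- q) - g (- p) * dotr (grad g (- q)) w <= 0.
Proof.
move=> gle0 gC1 g0 pq pqw.
pose mu : probability (borel_rV R n) R := two_point p q.
pose K : set V := [set p; q]; pose T := approach p q w.
have cK : compact K := compact_pair (p := p) (q := q).
have sT : smooth_contraction K T := smooth_contraction_approach pq pqw.
have t01 : 0 <= (0 : R) <= 1 by rewrite lexx ler01.
have tI : `[0, 1]%classic (0 : R) by rewrite /= in_itv.
have cT : {within K, continuous (T 0)}.
  exact: (within_slice (contraction_homotopy (smooth_contraction_contraction sT)) tI).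
have cv : {within K, continuous (velocity T 0)}.
  exact: (within_slice (smooth_contraction_velocity sT) tI).
have in_K x : x \in K = (x == p) || (x == q).
  apply/idP/orP => [|[/eqP ->|/eqP ->]]; rewrite inE; last by right.
    by move=> [->|->]; [left|right].
  by left.
have K1 : mu K != 0%E.
  rewrite /mu/= two_pointE !diracE !in_K !eqxx orbT /= -EFinD -EFinM.
  by rewrite mulVf ?oner_neq0.
have gT x : 0 < g x by exact: g0.
have := gle0 mu K T cK (@msupport_two_point R n p q) sT 0 0 t01.
rewrite divergence_canonical_velocity//.
have int (f : V -> R) : {within K, continuous f} ->
    \int[mu]_(x in K) f x = (f p + f q) / 2 by exact: Rintegral_two_point.
have D0 := smoothed_density_gt0 gC1 cK cT 0 g0 K1.
rewrite pmulr_rle0; last by rewrite invr_gt0 exprn_gt0.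
have cg (h : V -> R) : continuous h -> {within K, continuous (fun x => h (0 - T 0 x))}.
  exact: continuous_translate.
have cgv (h : V -> R) (i : 'I_n) : continuous h ->
    {within K, continuous (fun x => h (0 - T 0 x) * velocity T 0 x ord0 i)}.
  move=> ch x; apply: cvgM; first exact: cg.
  exact: continuous_coord.
rewrite /smoothed_density int; last exact: cg gC1.1.
under eq_bigr => i _.
  rewrite int; last exact: cgv (gC1.2 i).2.
  rewrite int; last exact: cgv gC1.1.
  rewrite int; last exact: cg (gC1.2 i).2.
  rewrite /T !approach0 !sub0r velocity_approach_p// velocity_approach_q// mxE !mulr0 !addr0.
  over.
(* The products with both factors taken at [- p] cancel; the masses 1/2 account for the factor 4. *)
have -> : dotr (grad g (- p)) w * g (- q) - g (- p) * dotr (grad g (- q)) w =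
    4 * (\sum_(i < n) ((g (- p) + g (- q)) / 2 * (partial i g (- p) * w ord0 i / 2) -
    g (- p) * w ord0 i / 2 * ((partial i g (- p) + partial i g (- q)) / 2))).
  rewrite /dotr mulr_suml !mulr_sumr -sumrB; apply: eq_bigr => i _.
  by rewrite !mxE; field.
by rewrite pmulr_rle0.
Qed.

(** The two-point test at [- u] and [- v] bounds the score increment on short vectors of the
    half-space [dotr (v - u) w < 0]. The bound is homogeneous in [w], hence holds on the whole
    half-space, and duality applies. *)
Lemma score_increment (g : V -> R) (u v : V) :
  contraction_divergence_le0 g -> is_C1 g -> (forall x, 0 < g x) -> u != v ->
  exists2 l : R, 0 <= l &
    (g u)^-1 *: grad g u - (g v)^-1 *: grad g v = l *: (v - u).
Proof.
move=> gle0 gC1 g0 uv; apply: half_space_dual; first by rewrite subr_eq0 eq_sym.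
move=> w dw.
have w0 : w != 0 by apply: contraTneq dw => ->; rewrite -(scale0r 0) dotrZr mul0r ltxx.
have ww := dotr_gt0 w0.
(* With this scaling [e *: w] satisfies the length restriction of the test with equality. *)
pose e : R := - dotr (v - u) w / dotr w w.
have e0 : 0 < e by rewrite divr_gt0// oppr_gt0.
have := @two_point_test g (- u) (- v) (e *: w) gle0 gC1 g0.
rewrite !opprK eqr_opp (addrC (- u)) => /(_ uv).
rewrite !dotrZr dotrZl => /(_ _)/wrap[].
  by rewrite -mulrN ler_wpM2l ?(ltW e0)// /e divfK ?gt_eqF.
move=> H.
have gu := g0 u; have gv := g0 v.
rewrite -scaleN1r dotrDl !dotrZl mulN1r.
have -> : (g u)^-1 * dotr (grad g u) w - (g v)^-1 * dotr (grad g v) w =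
  (e * g u * g v)^-1 * (e * dotr (grad g u) w * g v - g u * (e * dotr (grad g v) w)).
  by field; rewrite !gt_eqF.
by rewrite pmulr_rle0// invr_gt0 mulr_gt0// mulr_gt0.
Qed.

Lemma score_affine (g : V -> R) : (2 <= n)%N ->
  contraction_divergence_le0 g -> is_C1 g -> (forall x, 0 < g x) ->
  exists (c : V) (l : R), 0 <= l /\
    forall i x, partial i g x = (c ord0 i - l * x ord0 i) * g x.
Proof.
move=> n2 gle0 gC1 g0; pose F x := (g x)^-1 *: grad g x.
have [u v uv|k kP] := @parallel_increments_affine R n F n2.
  have [l _ lE] := score_increment gle0 gC1 g0 uv.
  by exists (- l); rewrite /F lE scaleNr -scalerN opprB.
exists (F 0), (- k); split.
  (* Parallel increments leave the sign of the slope open; the increment between one coordinate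
     vector and the origin determines it. *)
  pose e : V := delta_mx ord0 (Ordinal (ltnW n2)).
  have e0 : e != 0.
    by apply/eqP => /rowP/(_ (Ordinal (ltnW n2))); rewrite !mxE !eqxx; apply/eqP; rewrite oner_neq0.
  have [l l0 lE] := score_increment gle0 gC1 g0 e0.
  suff -> : - k = l by [].
  have : k *: e = (- l) *: e.
    have := kP e; rewrite /F => kE; move: lE; rewrite kE addrAC subrr add0r => ->.
    by rewrite sub0r scalerN scaleNr.
  move/rowP/(_ (Ordinal (ltnW n2))); rewrite !mxE !eqxx !mulr1 => ->.
  by rewrite opprK.
move=> i x; have /rowP/(_ i) := kP x; rewrite !mxE => H.
have gx := g0 x.
have -> : partial i g x = g x * ((g x)^-1 * partial i g x) by rewrite mulVKf// gt_eqF.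
by rewrite H; ring.
Qed.

End rigidity.

(** * From an affine score to the normalised Gaussian density *)

Section integration.
Context {R : realType} {n : nat}.
Local Notation V := 'rV[R]_n.

(** The logarithm of [g] on the line minus the claimed increment has zero derivative, hence equal
    values at [h] and 0. *)
Lemma log_line_affine_score (g : V -> R) (c : V) (l : R) (i : 'I_n) (x : V) (h : R) :
  is_C1 g -> (forall x, 0 < g x) ->
  (forall x, partial i g x = (c ord0 i - l * x ord0 i) * g x) ->
  ln (g (x + h *: delta_mx ord0 i)) =
    ln (g x) + (c ord0 i * h - l * (x ord0 i * h + h ^+ 2 / 2)).
Proof.
move=> gC1 g0 gE; pose e : V := delta_mx ord0 i.
(* [P] is the negative of the claimed increment, so [phi] should be constant. *)
pose P : R -> R := (- c ord0 i) \*: id + (l * x ord0 i) \*: id + (l / 2) \*: (id ^+ 2).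
pose phi : R -> R := (@ln R \o (fun t : R => g (x + t *: e))) + P.
have PE t : P t = - (c ord0 i * t - l * (x ord0 i * t + t ^+ 2 / 2)).
  by rewrite /P !fctE /= /GRing.scale /=; field.
have phi' (t : R) : is_derive t 1 phi 0.
  have gt0 := g0 (x + t *: e).
  have dg : is_derive t 1 (fun t => g (x + t *: e)) (partial i g (x + t *: e)).
    by apply: is_derive_line; apply: DeriveDef => //; exact: (gC1.2 i).1.
  have dP : is_derive t 1 P (- c ord0 i + l * x ord0 i + l * t).
    apply: is_derive_eq; rewrite /GRing.scale /= expr1.
    by field.
  have dl := @is_derive1_comp _ (@ln R) _ _ _ _ (is_derive1_ln gt0) dg.
  have -> : 0 = (g (x + t *: e))^-1 * partial i g (x + t *: e) +
      (- c ord0 i + l * x ord0 i + l * t).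
    by rewrite gE /e !mxE !eqxx /=; field; rewrite gt_eqF.
  exact: is_deriveD dl dP.
have := @is_derive_0_is_cst R phi h 0 phi'.
rewrite /phi !fctE /= !PE scale0r addr0 => H.
by move: H; rewrite -/e => H; lra.
Qed.

(** The point [x] is reached from the origin by changing one coordinate at a time, and the
    increments of the logarithm add up. *)
Lemma density_affine_score (g : V -> R) (c : V) (l : R) :
  is_C1 g -> (forall x, 0 < g x) ->
  (forall i x, partial i g x = (c ord0 i - l * x ord0 i) * g x) ->
  forall x, g x = g 0 * \prod_(i < n) expR (c ord0 i * x ord0 i - l * x ord0 i ^+ 2 / 2).
Proof.
move=> gC1 g0 gE x.
have partial_sum (r : seq 'I_n) : uniq r ->
    ln (g (\sum_(i <- r) x ord0 i *: delta_mx ord0 i)) =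
    ln (g 0) + \sum_(i <- r) (c ord0 i * x ord0 i - l * x ord0 i ^+ 2 / 2).
  elim: r => [|i r IH] /=; first by rewrite !big_nil addr0.
  move=> /andP[ir /IH{}IH]; rewrite !big_cons addrC.
  rewrite (log_line_affine_score _ _ gC1 g0 (gE i)) IH.
  (* The coordinate [i] has not been changed yet, because the list has no repetition; the mixed term
     of the increment therefore vanishes. *)
  have -> : (\sum_(j <- r) x ord0 j *: delta_mx ord0 j : V) ord0 i = 0.
    rewrite summxE big_seq; apply: big1 => j jr; rewrite !mxE eqxx /=.
    by rewrite (_ : (i == j) = false) ?mulr0//; apply/eqP => ij; rewrite ij jr in ir.
  by rewrite mul0r add0r; ring.
have := partial_sum (index_enum 'I_n) (index_enum_uniq _).
rewrite -row_sum_delta => lgx.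
by rewrite -[LHS]lnK ?posrE// lgx expRD lnK ?posrE// expR_sum.
Qed.

Lemma expe_pinfty (m : nat) : (0 < m)%N -> ((+oo : \bar R) ^+ m = +oo)%E.
Proof.
by case: m => // m _; elim: m => [|m IH]; rewrite ?expe1// expeS IH mulyy.
Qed.

Lemma affine_score_isotropic_gaussian (g : V -> R) (c : V) (l : R) :
  (0 < n)%N -> is_C1 g -> (forall x, 0 < g x) ->
  (\int[lebesgue_rV R n]_x (g x)%:E = 1)%E -> 0 <= l ->
  (forall i x, partial i g x = (c ord0 i - l * x ord0 i) * g x) ->
  is_isotropic_gaussian g.
Proof.
move=> n0 gC1 g0 g1 l0 /(density_affine_score gC1 g0) gE.
(* The normalisation of [g] for a product form with equal one-dimensional integrals [k]. An infinite
   [k] is allowed, so that both cases for [l] are covered. *)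
have prod_int (C : R) (h : 'I_n -> R -> R) (k : \bar R) : 0 < C ->
    (forall i, measurable_fun [set: R] (h i)) -> (forall i x, 0 <= h i x) ->
    (forall i, \int[@lebesgue_measure R]_x (h i x)%:E = k)%E ->
    (forall x, g x = C * \prod_(i < n) h i (x ord0 i)) -> (C%:E * k ^+ n = 1)%E.
  move=> C0 mh h0 hk gC; rewrite -g1 -(integral_prod_coord mh h0 hk).
  rewrite -ge0_integralZl//; last 3 first.
  - by apply/measurable_EFinP; exact: (measurable_prod_coord mh).
  - by move=> x _; rewrite lee_fin; exact: prodr_ge0.
  - by rewrite lee_fin ltW.
  by apply: eq_integral => x _; rewrite gC EFinM.
(* For [l = 0] every one-dimensional factor has infinite integral, which contradicts total mass 1 as
   [n] is positive. *)
have [l_eq0|l_neq0] := eqVneq l 0.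
  have := @prod_int (g 0) (fun i x => expR (c ord0 i * x)) +oo%E (g0 0).
  rewrite expe_pinfty// gt0_muley ?lte_fin//.
  move=> /(_ _ _ _ _)/wrap[] //.
  - move=> i; apply: continuous_measurable_fun => x.
    apply: (@continuous_comp _ _ _ ( *%R (c ord0 i))); first exact: mulrl_continuous.
    exact: continuous_expR.
  - by move=> i; exact: integral_expR_infty.
  - move=> x; rewrite gE; congr (_ * _); apply: eq_bigr => i _.
    by rewrite l_eq0 !mul0r subr0.
have {l_neq0}l_gt0 : 0 < l by rewrite lt0r l_neq0.
(* Completing the square gives variance [1 / l] and centre [c / l]; [C] collects the constants that
   remain. *)
pose s := l^-1; have s0 : 0 < s by rewrite invr_gt0.
pose a : V := s *: c.
pose C := g 0 * \prod_(i < n) expR (a ord0 i ^+ 2 / (2 * s)).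
have gaussE x : g x = C * \prod_(i < n) expR (- ((x ord0 i - a ord0 i) ^+ 2 / (2 * s))).
  rewrite gE /C -mulrA -big_split /=; congr (_ * _); apply: eq_bigr => i _.
  rewrite -expRD; congr expR; rewrite /a mxE /s.
  by field; rewrite gt_eqF.
have C0 : 0 < C by rewrite mulr_gt0// prodr_gt0// => i _; exact: expR_gt0.
have := @prod_int C (fun i x => expR (- ((x - a ord0 i) ^+ 2 / (2 * s))))
  (Num.sqrt (2 * pi * s))%:E C0.
move=> /(_ _ _ _ _)/wrap[] //.
- move=> i.
  rewrite (_ : (fun x => _) = normal_fun (a ord0 i) (Num.sqrt s)).
    exact: measurable_normal_fun.
  by apply/funext => x; rewrite /normal_fun sqr_sqrtr ?ltW// mulNr mulr_natl.
- by move=> i; exact: integral_gaussian.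
rewrite -EFin_expe -EFinM => -[CE].
have ps : 0 < 2 * pi * s by rewrite !mulr_gt0// pi_gt0.
exists a, s; split=> // x; rewrite gaussE; congr (_ * _).
  (* Total mass 1 determines [C] as the inverse of the [n]-th power of the one-dimensional Gaussian
     integral. *)
  have -> : C = (Num.sqrt (2 * pi * s) ^+ n)^-1.
    have pn : Num.sqrt (2 * pi * s) ^+ n != 0 by rewrite expf_neq0// gt_eqF// sqrtr_gt0.
    by apply: (mulIf pn); rewrite CE mulVf.
  rewrite -powR12_sqrt ?ltW// -powR_mulrn ?powR_ge0// -powRrM -powRN.
  by congr (_ `^ _); rewrite mulrC.
rewrite -expR_sum; congr expR; rewrite enorm_sqr mulr_suml -sumrN.
by apply: eq_bigr => i _; rewrite !mxE.
Qed.

End integration.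

Theorem theorem1p12 (R : realType) (n : nat) (hn : (2 <= n)%N)
    (g : 'rV[R]_n -> R) (g_gt0 : forall x, 0 < g x) (g_C2 : is_C2 g)
    (g_int : (\int[lebesgue_rV R n]_x (g x)%:E = 1)%E) :
  (forall (mu : probability (borel_rV R n) R) (K : set 'rV[R]_n)
      (T : R -> 'rV[R]_n -> 'rV[R]_n),
      compact K -> msupport mu `<=` K -> smooth_contraction K T ->
      forall (t : R) (z : 'rV[R]_n), 0 <= t <= 1 ->
        divergence (canonical_velocity g mu K T t) z <= 0)
  <-> is_isotropic_gaussian g.
Proof.
split=> [gle0|gauss mu K T cK _ sT t z t01]; last first.
  exact: gaussian_divergence_le0 gauss g_C2.1 g_gt0 cK sT t01.
have [c [l [l0 gE]]] := score_affine hn gle0 g_C2.1 g_gt0.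
exact: affine_score_isotropic_gaussian (ltnW hn) g_C2.1 g_gt0 g_int l0 gE.
Qed.
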